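(* Let $k$ be a field, let $(R,\mathfrak m)$ be a regular local ring of Krull dimension $n$ containing $k$ with residue field $k$, let $w\in\mathfrak m$ be non-zero and $S=R/w$. Assume that there are $k$-linear derivations $\partial_1,\dots,\partial_n$ of $R$ with $\dim_kS/(\partial_1w,\dots,\partial_nw)<\infty$. Let $X,Y$ be objects of $\operatorname{MF}^\infty(R,w)$. A $0$-cycle $f$ in the morphism complex from $X$ to $Y$ induces an isomorphism in $[\operatorname{MF}^\infty(R,w)]$ if and only if $f$ induces a quasi-isomorphism between the ($\mathbb Z/2$-graded) complexes of $k$-modules $k\otimes_RX$ and $k\otimes_RY$.
   Context: $\operatorname{MF}^\infty(R,w)$ is the differential $\mathbb Z/2$-graded category of pairs $(X,d)$, where $X=X^0\oplus X^1$ is a $\mathbb Z/2$-graded free $R$-module of possibly infinite rank and $d$ is an odd $R$-linear endomorphism with $d^2=w\,\mathrm{id}_X$; morphism complexes are the $\mathbb Z/2$-graded modules of $R$-linear maps with $d(f)=d_{X'}f-(-1)^{|f|}fd_X$. The homotopy category $[\operatorname{MF}^\infty(R,w)]$ is obtained by applying $H^0$ to morphism complexes. Since $w\in\mathfrak m$, $k\otimes_RX$ with the induced differential is a $\mathbb Z/2$-graded complex. *)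

(* Defs.v *)
From HB Require Import structures.
From mathcomp Require Import all_boot all_order all_algebra.
From mathcomp Require Import finmap.
From mathcomp Require Import boolp classical_sets.

Set Implicit Arguments.
Unset Strict Implicit.
Unset Printing Implicit Defensive.

Import GRing.Theory.

Local Open Scope ring_scope.
Local Open Scope classical_set_scope.
Local Open Scope quotient_scope.

(* Ideals are [set R]: the closure predicates of [ring_quotient] apply to
   boolean predicates only and exclude the unit ideal. *)
Section RegularLocal.
Variable R : comNzRingType.
Implicit Types I J P m : set R.

Definition is_ideal I :=
  [/\ I 0, forall x y, I x -> I y -> I (x + y)
    & forall a x, I x -> I (a * x)].

Definition is_prime P :=
  [/\ is_ideal P, ~ P 1 & forall x y, P (x * y) -> P x \/ P y].

Definition is_maximal m :=
  [/\ is_ideal m, ~ m 1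
    & forall I, is_ideal I -> ~ I 1 -> m `<=` I -> I = m].

Definition ideal_gen n (g : 'I_n -> R) : set R :=
  [set x | exists c : 'I_n -> R, x = \sum_(i < n) c i * g i].

Definition noetherian :=
  forall I, is_ideal I -> exists n (g : 'I_n -> R), I = ideal_gen g.

Definition is_local m :=
  is_maximal m /\ forall m', is_maximal m' -> m' = m.

(* a chain P_0 < ... < P_l of length l, i.e. with l + 1 primes *)
Definition has_prime_chain l :=
  exists P : 'I_l.+1 -> set R,
    (forall i, is_prime (P i)) /\
    (forall i j : 'I_l.+1, (i < j)%N -> P i `<` P j).

Definition krull_dim n :=
  has_prime_chain n /\ forall l, has_prime_chain l -> (l <= n)%N.

Definition regular_local m n :=
  [/\ noetherian, is_local m, krull_dim n
    & exists g : 'I_n -> R, m = ideal_gen g].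

End RegularLocal.

Definition derivation (k : fieldType) (R : comAlgType k) (D : R -> R) :=
  forall a b, D (a * b) = a * D b + D a * b.

(* A k-algebra morphism R -> k is onto, so one with kernel m identifies the
   residue field R/m with k, compatibly with the embedding of k in R. *)
Definition is_residue_map (k : fieldType) (R : comAlgType k) (m : set R)
    (res : {lrmorphism R -> k | *%R}) :=
  forall r, m r <-> res r = 0.

(* dim_k (V / U) < oo, for a subspace U of V *)
Definition finite_codim (k : fieldType) (V : lmodType k) (U : set V) :=
  exists N (e : 'I_N -> V), forall v, exists c : 'I_N -> k,
    U (v - \sum_(i < N) c i *: e i).

(* The preimage in R of the ideal of R/w generated by the classes of the
   g i, so that R / ideal_mod_gen w g = (R/w) / (g 1, ..., g n). *)
Definition ideal_mod_gen (R : comNzRingType) (w : R) n (g : 'I_n -> R) :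
    set R :=
  [set x | exists (a : R) (c : 'I_n -> R),
     x = a * w + \sum_(i < n) c i * g i].

Definition is_free (R : comNzRingType) (V : lmodType R) :=
  exists (I : choiceType) (b : I -> V),
    forall v : V, exists! c : {fsfun I -> R with 0},
      v = \sum_(i <- finsupp c) c i *: b i.

(* K (x)_R X for a ring morphism p : R -> K, as a K-module: formal finite sums of pure
   tensors, modulo the relations of the tensor product. *)
Section Tensor.
Variables (R K : comNzRingType) (p : {rmorphism R -> K}) (X : lmodType R).
Implicit Types s t u : seq (K * X).

Inductive tens_rel : seq (K * X) -> seq (K * X) -> Prop :=
| tens_refl s : tens_rel s s
| tens_sym s t : tens_rel s t -> tens_rel t s
| tens_trans s t u : tens_rel s t -> tens_rel t u -> tens_rel s u
| tens_cat s s' t t' :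
    tens_rel s s' -> tens_rel t t' -> tens_rel (s ++ t) (s' ++ t')
| tens_catC s t : tens_rel (s ++ t) (t ++ s)
| tens_0l x : tens_rel [:: (0, x)] [::]
| tens_Dl a b x : tens_rel [:: (a + b, x)] [:: (a, x); (b, x)]
| tens_Dr a x y : tens_rel [:: (a, x + y)] [:: (a, x); (a, y)]
| tens_Z a r x : tens_rel [:: (a * p r, x)] [:: (a, r *: x)].

Definition tens_relb s t := `[< tens_rel s t >].

Lemma tens_relb_refl : reflexive tens_relb.
Proof. by move=> s; apply/asboolP/tens_refl. Qed.

Lemma tens_relb_sym : symmetric tens_relb.
Proof.
by move=> s t; apply/idP/idP => /asboolP h; apply/asboolP/tens_sym.
Qed.

Lemma tens_relb_trans : transitive tens_relb.
Proof.
move=> t s u /asboolP h1 /asboolP h2; apply/asboolP.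
exact: tens_trans h1 h2.
Qed.

Canonical tens_equiv :=
  EquivRel tens_relb tens_relb_refl tens_relb_sym tens_relb_trans.

Definition tensor := {eq_quot tens_equiv}.

HB.instance Definition _ := Choice.on tensor.
HB.instance Definition _ := EqQuotient.on tensor.

Lemma tens_piE s t : \pi_tensor s = \pi_tensor t <-> tens_rel s t.
Proof.
split=> [/eqmodP/asboolP //|h].
by apply/eqmodP/asboolP.
Qed.

Lemma tens_ind (P : tensor -> Prop) :
  (forall s, P (\pi_tensor s)) -> forall x, P x.
Proof. by move=> h x; rewrite -[x]reprK. Qed.

Lemma tens_repr s : tens_rel (repr (\pi_tensor s)) s.
Proof. by apply/tens_piE; rewrite reprK. Qed.

Definition tscale_seq (c : K) s := [seq (c * z.1, z.2) | z <- s].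

Lemma tscale_seq_rel c s t :
  tens_rel s t -> tens_rel (tscale_seq c s) (tscale_seq c t).
Proof.
elim=> {s t} /=.
- by move=> s; apply: tens_refl.
- by move=> s t _; apply: tens_sym.
- by move=> s t u _ h1 _ h2; apply: tens_trans h1 h2.
- by move=> s s' t t' _ h1 _ h2; rewrite /tscale_seq !map_cat; apply: tens_cat.
- by move=> s t; rewrite /tscale_seq !map_cat; apply: tens_catC.
- by move=> x; rewrite mulr0; apply: tens_0l.
- by move=> a b x; rewrite mulrDr; apply: tens_Dl.
- by move=> a x y; apply: tens_Dr.
- by move=> a r x; rewrite mulrA; apply: tens_Z.
Qed.

Lemma tscale_seqA a b s :
  tscale_seq a (tscale_seq b s) = tscale_seq (a * b) s.
Proof.
by rewrite /tscale_seq -map_comp; apply: eq_map => z /=; rewrite mulrA.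
Qed.

Lemma tscale_seqDl a b s :
  tens_rel (tscale_seq (a + b) s) (tscale_seq a s ++ tscale_seq b s).
Proof.
elim: s => [|z s IH]; first exact: tens_refl.
rewrite {1}/tscale_seq map_cons mulrDl -cat1s.
apply: tens_trans (tens_cat (tens_Dl _ _ _) IH) _.
rewrite {3 4}/tscale_seq !map_cons -!/(tscale_seq _ s).
set A := tscale_seq a s; set B := tscale_seq b s.
set x := (a * z.1, z.2); set y := (b * z.1, z.2).
rewrite -[_ ++ _]/([:: x] ++ (([:: y] ++ A) ++ B)).
have -> : (x :: A) ++ y :: B = [:: x] ++ ((A ++ [:: y]) ++ B).
  by rewrite -catA.
apply: tens_cat; first exact: tens_refl.
by apply: tens_cat; [apply: tens_catC|apply: tens_refl].
Qed.

Lemma tscale_seq0 s : tens_rel (tscale_seq 0 s) [::].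
Proof.
elim: s => [|z s IH] /=; first exact: tens_refl.
rewrite mul0r -cat1s -[[::]]/([::] ++ [::]).
by apply: tens_cat => //; apply: tens_0l.
Qed.

Definition tens_add (x y : tensor) : tensor := \pi_tensor (repr x ++ repr y).
Definition tens_scale (c : K) (x : tensor) : tensor :=
  \pi_tensor (tscale_seq c (repr x)).
Definition tens_opp (x : tensor) : tensor := tens_scale (-1) x.

Lemma tens_add_pi s t : tens_add (\pi_tensor s) (\pi_tensor t) = \pi_tensor (s ++ t).
Proof. by apply/tens_piE/tens_cat; apply: tens_repr. Qed.

Lemma tens_scale_pi c s : tens_scale c (\pi_tensor s) = \pi_tensor (tscale_seq c s).
Proof. by apply/tens_piE/tscale_seq_rel/tens_repr. Qed.

Lemma tens_addA : associative tens_add.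
Proof.
elim/tens_ind=> s; elim/tens_ind=> t; elim/tens_ind=> u.
by rewrite !tens_add_pi catA.
Qed.

Lemma tens_addC : commutative tens_add.
Proof.
elim/tens_ind=> s; elim/tens_ind=> t; rewrite !tens_add_pi.
exact/tens_piE/tens_catC.
Qed.

Lemma tens_add0 : left_id (\pi_tensor [::]) tens_add.
Proof. by elim/tens_ind=> s; rewrite tens_add_pi. Qed.

Lemma tens_addN : left_inverse (\pi_tensor [::]) tens_opp tens_add.
Proof.
elim/tens_ind=> s; rewrite /tens_opp tens_scale_pi tens_add_pi; apply/tens_piE.
have e : s = tscale_seq 1 s.
  by rewrite -[LHS]map_id; apply: eq_map => -[a x] /=; rewrite mul1r.
rewrite [X in _ ++ X]e; apply: tens_trans (tens_sym (tscale_seqDl _ _ _)) _.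
by rewrite addNr; apply: tscale_seq0.
Qed.

HB.instance Definition _ := GRing.isZmodule.Build tensor
  tens_addA tens_addC tens_add0 tens_addN.

Lemma tens_scaleA a b x :
  tens_scale a (tens_scale b x) = tens_scale (a * b) x.
Proof.
by elim/tens_ind: x => s; rewrite !tens_scale_pi tscale_seqA.
Qed.

Lemma tens_scale1 : left_id 1 tens_scale.
Proof.
elim/tens_ind=> s; rewrite tens_scale_pi; congr (\pi_tensor _).
by rewrite -[RHS]map_id; apply: eq_map => -[a x] /=; rewrite mul1r.
Qed.

Lemma tens_scaleDr : right_distributive tens_scale +%R.
Proof.
move=> c; elim/tens_ind=> s; elim/tens_ind=> t.
rewrite -[\pi_tensor s + \pi_tensor t]/(tens_add _ _) -[RHS]/(tens_add _ _).
by rewrite tens_add_pi !tens_scale_pi tens_add_pi /tscale_seq map_cat.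
Qed.

Lemma tens_scaleDl x : {morph tens_scale^~ x : a b / a + b}.
Proof.
elim/tens_ind: x => s a b /=; rewrite -[RHS]/(tens_add _ _).
rewrite !tens_scale_pi tens_add_pi; exact/tens_piE/tscale_seqDl.
Qed.

HB.instance Definition _ := GRing.Zmodule_isLmodule.Build K tensor
  tens_scaleA tens_scale1 tens_scaleDr tens_scaleDl.

Definition tens (a : K) (x : X) : tensor := \pi_tensor [:: (a, x)].

Lemma tensor_piD s t : \pi_tensor (s ++ t) = \pi_tensor s + \pi_tensor t.
Proof. by rewrite -tens_add_pi. Qed.

Lemma tensor_piZ c s : \pi_tensor (tscale_seq c s) = c *: \pi_tensor s.
Proof. by rewrite -tens_scale_pi. Qed.

End Tensor.

Section TensorMap.
Variables (R K : comNzRingType) (p : {rmorphism R -> K}).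
Variables (X Y : lmodType R) (f : {linear X -> Y}).

Definition tmap_seq (s : seq (K * X)) : seq (K * Y) :=
  [seq (z.1, f z.2) | z <- s].

Lemma tmap_seq_rel s t :
  tens_rel p s t -> tens_rel p (tmap_seq s) (tmap_seq t).
Proof.
elim=> {s t} /=.
- by move=> s; apply: tens_refl.
- by move=> s t _; apply: tens_sym.
- by move=> s t u _ h1 _ h2; apply: tens_trans h1 h2.
- by move=> s s' t t' _ h1 _ h2; rewrite /tmap_seq !map_cat; apply: tens_cat.
- by move=> s t; rewrite /tmap_seq !map_cat; apply: tens_catC.
- by move=> x; apply: tens_0l.
- by move=> a b x; apply: tens_Dl.
- by move=> a x y; rewrite linearD; apply: tens_Dr.
- by move=> a r x; rewrite linearZ; apply: tens_Z.
Qed.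

Definition tens_map (x : tensor p X) : tensor p Y := \pi_(tensor p Y) (tmap_seq (repr x)).

Lemma tens_map_pi s : tens_map (\pi_(tensor p X) s) = \pi_(tensor p Y) (tmap_seq s).
Proof. by apply/tens_piE/tmap_seq_rel/tens_repr. Qed.

Lemma tens_map_tens a x : tens_map (tens p a x) = tens p a (f x).
Proof. exact: tens_map_pi. Qed.

Lemma tens_map_linear : linear tens_map.
Proof.
move=> c; elim/tens_ind=> s; elim/tens_ind=> t.
rewrite -tensor_piZ -tensor_piD !tens_map_pi -tensor_piZ -tensor_piD.
by congr (\pi_(tensor p _) _); rewrite /tmap_seq /tscale_seq map_cat -!map_comp.
Qed.

HB.instance Definition _ :=
  GRing.isLinear.Build K (tensor p X) (tensor p Y) *:%R tens_map
    tens_map_linear.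

End TensorMap.

Lemma tens_map_comp_eq (R K : comNzRingType) (p : {rmorphism R -> K})
    (X Y Y' Z : lmodType R) (f : {linear X -> Y}) (g : {linear Y -> Z})
    (f' : {linear X -> Y'}) (g' : {linear Y' -> Z}) :
  (forall x, g (f x) = g' (f' x)) ->
  forall x : tensor p X,
    tens_map g (tens_map f x) = tens_map g' (tens_map f' x).
Proof.
move=> e; elim/tens_ind=> s; rewrite !tens_map_pi; congr (\pi_(tensor p _) _).
by rewrite /tmap_seq -!map_comp; apply: eq_map => z /=; rewrite e.
Qed.

Lemma tens_map_comp0 (R K : comNzRingType) (p : {rmorphism R -> K})
    (X Y : lmodType R) (f : {linear X -> Y}) (g : {linear Y -> X}) (w : R) :
  p w = 0 -> (forall x, g (f x) = w *: x) ->
  forall x : tensor p X, tens_map g (tens_map f x) = 0.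
Proof.
move=> pw e; elim/tens_ind=> s; rewrite !tens_map_pi.
apply: (@etrans _ _ (\pi_(tensor p X) [::])) => //; apply/tens_piE.
elim: s => [|[a x] s IH] /=; first exact: tens_refl.
rewrite -cat1s -[[::]]/([::] ++ [::]); apply: tens_cat => //=.
by rewrite e; apply: tens_trans (tens_sym (tens_Z p _ _ _)) _;
   rewrite pw mulr0; apply: tens_0l.
Qed.

Record complex2 (K : comNzRingType) := Complex2 {
  cpx0 : lmodType K;
  cpx1 : lmodType K;
  cpx_d0 : {linear cpx0 -> cpx1};
  cpx_d1 : {linear cpx1 -> cpx0};
  cpx_d1d0 : forall x, cpx_d1 (cpx_d0 x) = 0;
  cpx_d0d1 : forall x, cpx_d0 (cpx_d1 x) = 0 }.

Record chain_map2 (K : comNzRingType) (C D : complex2 K) := ChainMap2 {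
  chm0 : {linear cpx0 C -> cpx0 D};
  chm1 : {linear cpx1 C -> cpx1 D};
  chm_d0 : forall x, cpx_d0 D (chm0 x) = chm1 (cpx_d0 C x);
  chm_d1 : forall x, cpx_d1 D (chm1 x) = chm0 (cpx_d1 C x) }.

Section QuasiIso.
Variables (K : comNzRingType) (C D : complex2 K) (f : chain_map2 C D).

(* f induces an injection, resp. a surjection, on
   H^0 = ker d0 / im d1 and on H^1 = ker d1 / im d0. *)
Definition H0_inj := forall x, cpx_d0 C x = 0 ->
  (exists y, chm0 f x = cpx_d1 D y) -> exists z, x = cpx_d1 C z.
Definition H0_surj := forall y, cpx_d0 D y = 0 ->
  exists x, cpx_d0 C x = 0 /\ exists z, y - chm0 f x = cpx_d1 D z.
Definition H1_inj := forall x, cpx_d1 C x = 0 ->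
  (exists y, chm1 f x = cpx_d0 D y) -> exists z, x = cpx_d0 C z.
Definition H1_surj := forall y, cpx_d1 D y = 0 ->
  exists x, cpx_d1 C x = 0 /\ exists z, y - chm1 f x = cpx_d0 D z.

Definition quasi_iso := (H0_inj /\ H0_surj) /\ (H1_inj /\ H1_surj).

End QuasiIso.

Record MFinf (R : comNzRingType) (w : R) := MatrixFactorization {
  mf0 : lmodType R;
  mf1 : lmodType R;
  mf0_free : is_free mf0;
  mf1_free : is_free mf1;
  mf_d0 : {linear mf0 -> mf1};
  mf_d1 : {linear mf1 -> mf0};
  mf_d1d0 : forall x, mf_d1 (mf_d0 x) = w *: x;
  mf_d0d1 : forall x, mf_d0 (mf_d1 x) = w *: x }.

Section MorphismComplex.
Variables (R : comNzRingType) (w : R).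
Implicit Types X Y Z : MFinf w.

Definition hom0 X Y : Type :=
  ({linear mf0 X -> mf0 Y} * {linear mf1 X -> mf1 Y})%type.
Definition hom1 X Y : Type :=
  ({linear mf0 X -> mf1 Y} * {linear mf1 X -> mf0 Y})%type.

Definition hom_d0 X Y (f : hom0 X Y) : hom1 X Y :=
  ((mf_d0 Y \o f.1) \- (f.2 \o mf_d0 X) : {linear _ -> _},
   (mf_d1 Y \o f.2) \- (f.1 \o mf_d1 X) : {linear _ -> _}).

Definition hom_d1 X Y (h : hom1 X Y) : hom0 X Y :=
  ((mf_d1 Y \o h.1) \+ (h.2 \o mf_d0 X) : {linear _ -> _},
   (mf_d0 Y \o h.2) \+ (h.1 \o mf_d1 X) : {linear _ -> _}).

Definition is_cycle0 X Y (f : hom0 X Y) :=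
  (forall x, (hom_d0 f).1 x = 0) /\ (forall x, (hom_d0 f).2 x = 0).

Definition hom_id X : hom0 X X := (idfun : {linear _ -> _}, idfun : {linear _ -> _}).

Definition hom_comp X Y Z (g : hom0 Y Z) (f : hom0 X Y) : hom0 X Z :=
  (g.1 \o f.1 : {linear _ -> _}, g.2 \o f.2 : {linear _ -> _}).

(* For cycles f and g: their classes in H^0 are equal. *)
Definition homotopic X Y (f g : hom0 X Y) :=
  exists h : hom1 X Y, (forall x, f.1 x - g.1 x = (hom_d1 h).1 x) /\
                       (forall x, f.2 x - g.2 x = (hom_d1 h).2 x).

(* For a cycle f: its class is an isomorphism of the category H^0. *)
Definition homotopy_iso X Y (f : hom0 X Y) :=
  exists g : hom0 Y X, [/\ is_cycle0 g, homotopic (hom_comp g f) (hom_id X)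
                         & homotopic (hom_comp f g) (hom_id Y)].

End MorphismComplex.

Section BaseChange.
Variables (R K : comNzRingType) (p : {rmorphism R -> K}) (w : R).
Hypothesis pw : p w = 0.

Definition tensor_mf (X : MFinf w) : complex2 K :=
  @Complex2 K (tensor p (mf0 X)) (tensor p (mf1 X))
    (tens_map (mf_d0 X)) (tens_map (mf_d1 X))
    (tens_map_comp0 pw (@mf_d1d0 _ _ X)) (tens_map_comp0 pw (@mf_d0d1 _ _ X)).

Lemma is_cycle0_comm0 (X Y : MFinf w) (f : hom0 X Y) : is_cycle0 f ->
  forall x, mf_d0 Y (f.1 x) = f.2 (mf_d0 X x).
Proof. by case=> h _ x; apply: subr0_eq; apply: h. Qed.

Lemma is_cycle0_comm1 (X Y : MFinf w) (f : hom0 X Y) : is_cycle0 f ->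
  forall x, mf_d1 Y (f.2 x) = f.1 (mf_d1 X x).
Proof. by case=> _ h x; apply: subr0_eq; apply: h. Qed.

Definition tensor_mf_map (X Y : MFinf w) (f : hom0 X Y) (hf : is_cycle0 f) :
    chain_map2 (tensor_mf X) (tensor_mf Y) :=
  @ChainMap2 K (tensor_mf X) (tensor_mf Y) (tens_map f.1) (tens_map f.2)
    (tens_map_comp_eq (is_cycle0_comm0 hf))
    (tens_map_comp_eq (is_cycle0_comm1 hf)).

End BaseChange.

Arguments regular_local {R} m n.
Arguments tensor_mf {R K} p {w} pw X.
Arguments tensor_mf_map {R K} p {w} pw {X Y f} hf.

(* Main.v *)
Require Import Defs.
From HB Require Import structures.
From mathcomp Require Import all_boot all_order all_algebra.
From mathcomp Require Import finmap.
From mathcomp Require Import boolp classical_sets.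

Set Implicit Arguments.
Unset Strict Implicit.
Unset Printing Implicit Defensive.

Import GRing.Theory.
Local Open Scope ring_scope.

(* The cone Z of f, with the parity of its elements forgotten, is a module with
   d^2 = w, and f is a homotopy equivalence iff Z is contractible, i.e.
   1 = d a + a d for some linear a. The r in R for which r = d l + l d has a
   linear solution l form an ideal. It contains w (take l = d on even elements)
   and D w for every derivation D (take the commutator of d with an extension
   of D to Z), so finiteness of S / (D_1 w, ..., D_n w) puts a power of every
   element of m in it.
   By Noetherian induction on an ideal I, every linear e with d e = e d modulo
   I Z is of the form d a + a d modulo I Z; contractibility is the case I = 0,
   e = 1. For I = m this is the acyclicity of k (x) Z. Otherwise pick r in m
   outside I: the induction hypothesis for I + (r) gives e = d a + a d + r b
   with b a cycle modulo (I : r). If (I : r) is larger than I, the induction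
   hypothesis applies to b; if (I : r) = I, iterating replaces r by r^N, which
   is null-homotopic. *)

(** * Noetherian local rings *)

(** [Zorn_bigcup] also ranges over the empty chain, whose union is empty, so [Q] adjoins the empty
    set to [P]. A maximal member of [Q] satisfies [P]: if empty, it lies below [A0] and hence equals
    it. *)
Lemma Zorn_above (T : Type) (P : set (set T)) (A0 : set T) : P A0 ->
  (forall F : set (set T), (exists A, F A) -> (forall A, F A -> P A) ->
     total_on F subset -> P (\bigcup_(X in F) X)%classic) ->
  exists A, P A /\ forall B, P B -> (A `<=` B)%classic -> B = A.
Proof.
move=> PA0 PU; pose Q A := A = set0 \/ P A.
have [F FQ Ftot|A [QA Amax]] := @Zorn_bigcup T Q.
  have [[A [FA PA]]|noP] := pselect (exists A, F A /\ P A); last first.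
    left; rewrite -subset0 => x [A FA Ax].
    case: (FQ _ FA) => [A0e|PA]; first by rewrite A0e in Ax.
    by case: noP; exists A.
  right.
  have -> : (\bigcup_(X in F) X = \bigcup_(X in F `&` P) X)%classic.
    apply/seteqP; split=> x [B FB Bx].
      case: (FQ _ FB) => [B0|PB]; first by rewrite B0 in Bx.
      by exists B.
    by case: FB => FB _; exists B.
  apply: PU; [by exists A | by move=> B [] |].
  by move=> B B' [FB _] [FB' _]; apply: Ftot.
have maxA B : Q B -> (A `<=` B)%classic -> B = A.
  move=> QB AB; apply: contrapT => neB; apply: (Amax B) => //.
  by split=> // BA; apply: neB; apply/seteqP.
have PA : P A.
  case: QA => // A0e; rewrite -(maxA A0) //; last by rewrite A0e.
  by right.
by exists A; split=> // B PB; apply: maxA; right.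
Qed.

Section Noetherian.
Variable R : comNzRingType.
Implicit Types I : set R.
Hypothesis noethR : noetherian R.

Lemma ideal_sum I n (a : 'I_n -> R) : is_ideal I ->
  (forall i, I (a i)) -> I (\sum_i a i).
Proof. by case=> I0 ID _ Ia; apply: (big_ind I) => // i _; apply: Ia. Qed.

(** Among the ideals that fail [Q], Zorn's lemma would give a maximal one, against the induction
    step. It applies because the union of a chain of ideals is finitely generated: one member
    contains all the generators and so equals the union. *)
Lemma noetherian_ind (Q : set R -> Prop) :
  (forall I, is_ideal I ->
     (forall I', is_ideal I' -> (I `<=` I')%classic -> I' <> I -> Q I') ->
     Q I) ->
  forall I, is_ideal I -> Q I.
Proof.
move=> step I0 idI0; apply: contrapT => nQ0.
pose P I := is_ideal I /\ ~ Q I.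
have [//|F [A FA] FP Ftot|I [[idI nQ] Imax]] := @Zorn_above R P I0.
  set U := (\bigcup_(X in F) X)%classic.
  have idF B : F B -> is_ideal B by move=> /FP [].
  have idU : is_ideal U; first split.
  - by exists A => //; case: (idF _ FA).
  - move=> x y [B FB Bx] [B' FB' B'y].
    have [sB|sB] := Ftot _ _ FB FB'; [exists B'|exists B] => //.
      by case: (idF _ FB') => _ D _; apply: D => //; apply: sB.
    by case: (idF _ FB) => _ D _; apply: D => //; apply: sB.
  - move=> a x [B FB Bx]; exists B => //.
    by case: (idF _ FB) => _ _; apply.
  have [n [g Ug]] := noethR idU.
  suff [B FB gB] : exists2 B, F B & forall i, B (g i).
    have <- : B = U; last exact: FP.
    apply/seteqP; split=> [x Bx|x]; first by exists B.
    rewrite Ug => -[c ->]; apply: ideal_sum; first exact: idF.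
    by move=> i; case: (idF _ FB) => _ _; apply.
  have Fg i : exists2 B, F B & B (g i).
    have : U (g i).
      rewrite Ug; exists (fun j => (j == i)%:R).
      rewrite (bigD1 i) //= eqxx mul1r big1 ?addr0 // => j /negPf ->.
      by rewrite mul0r.
    by case=> B FB Bg; exists B.
  suff [B FB gB] : exists2 B, F B & forall i, i \in enum 'I_n -> B (g i).
    by exists B => // i; apply: gB; rewrite mem_enum.
  elim: (enum 'I_n) => [|i s [B FB IH]]; first by exists A.
  have [B' FB' B'g] := Fg i.
  have [sB|sB] := Ftot _ _ FB FB'; [exists B'|exists B] => // j;
    by rewrite inE => /orP[/eqP->|/IH] //; apply: sB.
apply: nQ; apply: step => // I' idI' II' neI'.
by apply: contrapT => nQ'; apply: neI'; apply: Imax.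
Qed.

Variable m : set R.
Hypothesis locR : is_local m.

(** By Noetherian induction: a proper ideal that is not maximal lies in a larger proper one, already
    known to be inside m. *)
Lemma proper_ideal_sub I : is_ideal I -> ~ I 1 -> (I `<=` m)%classic.
Proof.
move=> idI; move: I idI; apply: noetherian_ind => I idI IH nI1.
have [maxI|] := pselect (is_maximal I); first by rewrite (locR.2 _ maxI).
move=> nmax; apply: contrapT => nsub; apply: nmax; split=> // I' idI' nI'1 II'.
apply: contrapT => neI; apply: nsub => x Ix.
exact: (IH I' idI' II' neI nI'1) (II' _ Ix).
Qed.

Lemma local_unit u : ~ m u -> exists a, a * u = 1.
Proof.
move=> nmu; pose I := [set x | exists a, x = a * u]%classic.
have idI : is_ideal I; first split.
- by exists 0; rewrite mul0r.
- by move=> x y [a ->] [b ->]; exists (a + b); rewrite mulrDl.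
- by move=> a x [b ->]; exists (a * b); rewrite mulrA.
apply: contrapT => nu; apply: nmu; apply: (proper_ideal_sub idI).
  by case=> a e; apply: nu; exists a.
by exists 1; rewrite mul1r.
Qed.

End Noetherian.

(** * Modules *)

Section SubmoduleIV.
Variables (R : comNzRingType) (V : lmodType R).
Implicit Types (I : set R) (u v : V).

Inductive ideal_mul I : V -> Prop :=
| ideal_mul0 : ideal_mul I 0
| ideal_mulD u v : ideal_mul I u -> ideal_mul I v -> ideal_mul I (u + v)
| ideal_mulZ a v : I a -> ideal_mul I (a *: v).

Lemma ideal_mul_scale I r v :
  is_ideal I -> ideal_mul I v -> ideal_mul I (r *: v).
Proof.
case=> _ _ IM; elim=> {v} [|u v _ IHu _ IHv|a v Ia].
- by rewrite scaler0; apply: ideal_mul0.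
- by rewrite scalerDr; apply: ideal_mulD.
- by rewrite scalerA; apply: ideal_mulZ; apply: IM.
Qed.

Lemma ideal_mulN I v : is_ideal I -> ideal_mul I v -> ideal_mul I (- v).
Proof. by move=> idI; rewrite -scaleN1r; apply: ideal_mul_scale. Qed.

Lemma ideal_mulB I u v :
  is_ideal I -> ideal_mul I u -> ideal_mul I v -> ideal_mul I (u - v).
Proof. by move=> idI Iu Iv; apply: ideal_mulD => //; apply: ideal_mulN. Qed.

Lemma ideal_mul_sub I I' v :
  (I `<=` I')%classic -> ideal_mul I v -> ideal_mul I' v.
Proof.
move=> sII'; elim=> {v} [|u v _ IHu _ IHv|a v Ia].
- exact: ideal_mul0.
- exact: ideal_mulD.
- by apply: ideal_mulZ; apply: sII'.
Qed.

End SubmoduleIV.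

Lemma ideal_mul_linear (R : comNzRingType) (V W : lmodType R)
    (f : {linear V -> W}) (I : set R) v :
  ideal_mul I v -> ideal_mul I (f v).
Proof.
elim=> {v} [|u v _ IHu _ IHv|a v Ia].
- by rewrite linear0; apply: ideal_mul0.
- by rewrite linearD; apply: ideal_mulD.
- by rewrite linearZ; apply: ideal_mulZ.
Qed.

Definition colon (R : comNzRingType) (I : set R) (r : R) : set R :=
  [set a | I (r * a)]%classic.

Definition linear_of (R : comNzRingType) (V W : lmodType R) (f : V -> W)
    (lf : linear f) : {linear V -> W} :=
  HB.pack f (GRing.isLinear.Build R V W *:%R f lf).

Section Pairs.
Variables (R : comNzRingType) (V W : lmodType R).

Lemma pair_inl_linear : linear (fun v => (v, 0) : V * W).
Proof. by move=> r x y; congr (_, _); rewrite /= scaler0 addr0. Qed.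

Lemma pair_inr_linear : linear (fun w => (0, w) : V * W).
Proof. by move=> r x y; congr (_, _); rewrite /= scaler0 addr0. Qed.

Definition pair_inl := linear_of pair_inl_linear.
Definition pair_inr := linear_of pair_inr_linear.

Lemma ideal_mul_pair (I : set R) (v : V) (w : W) :
  ideal_mul I v -> ideal_mul I w -> ideal_mul I ((v, w) : V * W).
Proof.
move=> Iv Iw.
have -> : (v, w) = pair_inl v + pair_inr w.
  by congr (_, _); rewrite /= ?addr0 ?add0r.
by apply: ideal_mulD; apply: ideal_mul_linear.
Qed.

End Pairs.

Arguments pair_inl {R V} W.
Arguments pair_inr {R} V {W}.

(** * Projectivity, flatness and connections *)

Section Tame.
Variable R : comNzRingType.
Implicit Types V W : lmodType R.

Definition linear_rel V W (P : V -> W -> Prop) :=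
  forall r v w v' w', P v w -> P v' w' -> P (r *: v + v') (r *: w + w').

(** A total linear relation is a submodule of V x W that maps onto V, and [L] splits this
    surjection. In this form linear maps can be chosen subject to congruences, with no quotient
    module. *)
Definition projective V := forall W (P : V -> W -> Prop),
  linear_rel P -> (forall v, exists w, P v w) ->
  exists L : {linear V -> W}, forall v, P v (L v).

(** Multiplication by r embeds R/(I : r) into R/I; the condition says that this map stays injective
    after tensoring with V, as it does for flat V. *)
Definition colon_flat V := forall (I : set R) (r : R) (v : V),
  is_ideal I -> ideal_mul I (r *: v) -> ideal_mul (colon I r) v.

Definition has_connections V := forall D : R -> R,
  (forall a b, D (a + b) = D a + D b) ->
  (forall a b, D (a * b) = a * D b + D a * b) ->
  exists N : V -> V, (forall u v, N (u + v) = N u + N v) /\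
    forall r v, N (r *: v) = r *: N v + D r *: v.

(* The properties of free modules that are used. Unlike freeness, they pass to
   products without any bookkeeping of bases. *)
Definition tame V := [/\ projective V, colon_flat V & has_connections V].

Lemma tame_prod V W : tame V -> tame W -> tame (V * W)%type.
Proof.
move=> [pV cV dV] [pW cW dW]; split.
- move=> U P linP totP.
  have P0 : P 0 0.
    have [u Pu] := totP 0.
    by have := linP (-1) _ _ _ _ Pu Pu; rewrite !scaleN1r !addNr.
  have [||L1 PL1] := pV U (fun v u => P (v, 0) u).
  + move=> r v u v' u' Pu Pu'; have := linP r _ _ _ _ Pu Pu'.
    by congr P; congr (_, _); rewrite /= scaler0 addr0.
  + by move=> v; apply: totP.
  have [||L2 PL2] := pW U (fun w u => P (0, w) u).
  + move=> r v u v' u' Pu Pu'; have := linP r _ _ _ _ Pu Pu'.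
    by congr P; congr (_, _); rewrite /= scaler0 addr0.
  + by move=> v; apply: totP.
  have lf : linear (fun x : V * W => L1 x.1 + L2 x.2).
    move=> r x y /=; rewrite !linearP !scalerDr; exact: addrACA.
  exists (linear_of lf) => -[v w] /=.
  have := linP 1 _ _ _ _ (PL1 v) (PL2 w); rewrite !scale1r.
  by congr P; congr (_, _) => /=; rewrite ?addr0 ?add0r.
- move=> I r [v w] idI h.
  apply: ideal_mul_pair; [apply: cV|apply: cW] => //.
    exact: (ideal_mul_linear (fst : {linear _ -> _}) h).
  exact: (ideal_mul_linear (snd : {linear _ -> _}) h).
- move=> D DD DM; have [N1 [N1D N1Z]] := dV D DD DM.
  have [N2 [N2D N2Z]] := dW D DD DM.
  exists (fun x => (N1 x.1, N2 x.2)); split.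
    by move=> u v; congr (_, _) => /=.
  by move=> r v; congr (_, _) => /=.
Qed.

Section Free.
Variables (V : lmodType R) (J : choiceType) (b : J -> V).
Hypothesis basis_b : forall v : V, exists! c : {fsfun J -> R with 0},
  v = \sum_(i <- finsupp c) c i *: b i.

Let co v : {fsfun J -> R with 0} := projT1 (cid (basis_b v)).

Let coE v : v = \sum_(i <- finsupp (co v)) co v i *: b i.
Proof. by rewrite /co; case: cid => c []. Qed.

Let co_uniq v c : v = \sum_(i <- finsupp c) c i *: b i -> co v = c.
Proof. by rewrite /co; case: cid => c' [_ u] /= /u. Qed.

(** Sums over the supports of different vectors become comparable once extended to a common finite
    set. *)
Let supp_sum (c : {fsfun J -> R with 0}) (S : {fset J}) W (F : J -> R -> W) :
  (forall i, F i 0 = 0) -> (finsupp c `<=` S)%fset ->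
  \sum_(i <- finsupp c) F i (c i) = \sum_(i <- S) F i (c i).
Proof.
move=> F0 sS; apply: big_fset_incl => // i _ ni.
by rewrite fsfun_dflt.
Qed.

Let co_eq v (S : {fset J}) (g : J -> R) :
  (forall i, i \notin S -> g i = 0) -> v = \sum_(i <- S) g i *: b i ->
  forall i, co v i = g i.
Proof.
move=> gS e; pose c : {fsfun J -> R with 0} := [fsfun i in S => g i | 0].
have cE i : c i = g i.
  by rewrite fsfunE; case: ifP => // /negbT /gS.
suff -> : co v = c by [].
apply: co_uniq; rewrite (supp_sum (S := S) (F := fun i a => a *: b i)).
- by rewrite e; apply: eq_bigr => i _; rewrite cE.
- by move=> i; rewrite scale0r.
- exact: finsupp_sub.
Qed.

Let coP r u v i : co (r *: u + v) i = r * co u i + co v i.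
Proof.
set S := (finsupp (co u) `|` finsupp (co v))%fset.
apply: (co_eq (S := S) (g := fun i => r * co u i + co v i)).
  move=> j; rewrite !inE negb_or => /andP[ju jv].
  by rewrite !fsfun_dflt // mulr0 addr0.
rewrite {1}(coE u) {1}(coE v).
rewrite (supp_sum (S := S) (F := fun i a => a *: b i)); first last.
- exact: fsubsetUl.
- by move=> j; rewrite scale0r.
rewrite (supp_sum (c := co v) (S := S) (F := fun i a => a *: b i)); first last.
- exact: fsubsetUr.
- by move=> j; rewrite scale0r.
rewrite scaler_sumr -big_split; apply: eq_bigr => j _ /=.
by rewrite scalerA scalerDl.
Qed.

Let coZ r u i : co (r *: u) i = r * co u i.
Proof.
have co0 : co 0 i = 0.
  by have := coP (-1) 0 0 i; rewrite scaler0 addr0 mulN1r addNr.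
by have := coP r u 0 i; rewrite addr0 co0 addr0.
Qed.

Let coD u v i : co (u + v) i = co u i + co v i.
Proof. by have := coP 1 u v i; rewrite scale1r mul1r. Qed.

(** All three properties are read in coordinates: a partner [w i] of each basis vector extends
    linearly; r v in I V forces r c in I for each coordinate c of v; a connection applies D to the
    coordinates. *)
Lemma basis_tame : tame V.
Proof.
split.
- move=> W P linP totP.
  have P0 : P 0 0.
    have [u Pu] := totP 0.
    by have := linP (-1) _ _ _ _ Pu Pu; rewrite !scaleN1r !addNr.
  have [w Pw] := choice (fun i => totP (b i)).
  pose L v := \sum_(i <- finsupp (co v)) co v i *: w i.
  have LS v (S : {fset J}) : (finsupp (co v) `<=` S)%fset ->
      L v = \sum_(i <- S) co v i *: w i.
    move=> sS; rewrite /L (supp_sum (S := S) (F := fun i a => a *: w i)) //.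
    by move=> j; rewrite scale0r.
  have lL : linear L.
    move=> r u v.
    set S := (finsupp (co u) `|` finsupp (co v) `|`
              finsupp (co (r *: u + v)))%fset.
    rewrite (LS _ S) ?fsubsetUr // (LS u S); last first.
      by rewrite /S -fsetUA fsubsetUl.
    rewrite (LS v S); last by rewrite /S fsetUAC fsubsetUr.
    rewrite scaler_sumr -big_split; apply: eq_bigr => j _ /=.
    by rewrite coP scalerDl scalerA.
  exists (linear_of lL) => v /=; rewrite {1}(coE v) /L.
  elim/big_ind2: _ => // [x1 x2 y1 y2 P1 P2|i _].
    by have := linP 1 _ _ _ _ P1 P2; rewrite !scale1r.
  by have := linP (co v i) _ _ _ _ (Pw i) P0; rewrite !addr0.
- move=> I r v idI h.
  have Ico : forall i, I (co (r *: v) i).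
    elim: h => [|u u' _ IHu _ IHu'|a u Ia] i.
    + rewrite -(scale0r 0) coZ mul0r; by case: idI.
    + by rewrite coD; case: idI => _ ID _; apply: ID.
    + by rewrite coZ mulrC; case: idI => _ _; apply.
  rewrite (coE v); apply: (big_ind (ideal_mul _)).
  + exact: ideal_mul0.
  + by move=> x y; apply: ideal_mulD.
  + by move=> i _; apply: ideal_mulZ; rewrite /colon /= -coZ.
- move=> D DD DM.
  have D0 : D 0 = 0 by apply: (addrI (D 0)); rewrite -DD !addr0.
  pose N v := \sum_(i <- finsupp (co v)) D (co v i) *: b i.
  have NS v (S : {fset J}) : (finsupp (co v) `<=` S)%fset ->
      N v = \sum_(i <- S) D (co v i) *: b i.
    move=> sS; rewrite /N (supp_sum (S := S) (F := fun i a => D a *: b i)) //.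
    by move=> j; rewrite D0 scale0r.
  exists N; split.
    move=> u v.
    set S := (finsupp (co u) `|` finsupp (co v) `|`
              finsupp (co (u + v)))%fset.
    rewrite (NS _ S) ?fsubsetUr // (NS u S); last first.
      by rewrite /S -fsetUA fsubsetUl.
    rewrite (NS v S); last by rewrite /S fsetUAC fsubsetUr.
    rewrite -big_split; apply: eq_bigr => j _ /=.
    by rewrite coD DD scalerDl.
  move=> r v; set S := (finsupp (co v) `|` finsupp (co (r *: v)))%fset.
  rewrite (NS _ S) ?fsubsetUr // /N {4}(coE v).
  rewrite (supp_sum (S := S) (F := fun i a => D a *: b i)); first last.
  + exact: fsubsetUl.
  + by move=> j; rewrite D0 scale0r.
  rewrite (supp_sum (S := S) (F := fun i a => a *: b i)); first last.
  + exact: fsubsetUl.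
  + by move=> j; rewrite scale0r.
  rewrite !scaler_sumr -big_split; apply: eq_bigr => j _ /=.
  by rewrite coZ DM scalerDl !scalerA.
Qed.

End Free.

Lemma free_tame V : is_free V -> tame V.
Proof. by case=> J [b hb]; apply: basis_tame hb. Qed.

End Tame.

(** The opposite of the leading term is moved to the front, where the two cancel. *)
Ltac zmod_cancel :=
  match goal with
  | |- - ?x + _ = 0 =>
      repeat (match goal with |- x + (- x + _) = 0 => fail 1 | _ => idtac end;
              rewrite [_ + (x + _)]addrCA);
      rewrite addrA subrr add0r
  | |- ?x + _ = 0 =>
      repeat (match goal with |- - x + (x + _) = 0 => fail 1 | _ => idtac end;
              rewrite [_ + (- x + _)]addrCA);
      rewrite addrA addNr add0r
  end.

(* Decides identities between signed sums of scaled atoms in a module. *)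
Ltac zmod :=
  apply: subr0_eq; rewrite ?(scalerDr, scalerN, scalerA, opprD, opprK, addr0, add0r, oppr0);
  (* The trailing 0 gives every term a right neighbour, as the rewriting patterns require. *)
  rewrite -[LHS]addr0 -?addrA; repeat zmod_cancel; done.

(** * Lifting contractions along the quotients R/I *)

Section Contraction.
Variables (R : comNzRingType) (m : set R) (Z : lmodType R).
Hypotheses (noethR : noetherian R) (locR : is_local m) (tameZ : tame Z).
Variables (w : R) (d : {linear Z -> Z}).
Hypothesis dd : forall z, d (d z) = w *: z.
Implicit Types (I : set R) (a b c e lam : {linear Z -> Z}).

(* Cycles and boundaries of the differential module Hom(Z, Z/IZ), with the
   parity of maps forgotten. *)
Definition commutes_mod I e :=
  forall z, ideal_mul I (d (e z) - e (d z)).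

Definition bounds_mod I a e :=
  forall z, ideal_mul I (e z - (d (a z) + a (d z))).

Lemma colon_ideal I r : is_ideal I -> is_ideal (colon I r).
Proof.
case=> I0 ID IM; split; rewrite /colon /=.
- by rewrite mulr0.
- by move=> x y; rewrite mulrDr; apply: ID.
- by move=> c x Ix; rewrite mulrCA; apply: IM.
Qed.

Lemma sub_colon I r : is_ideal I -> (I `<=` colon I r)%classic.
Proof. by case=> _ _ IM x Ix; apply: IM. Qed.

Lemma ideal_mul_colon I r (z : Z) :
  ideal_mul (colon I r) z -> ideal_mul I (r *: z).
Proof.
elim=> {z} [|u v _ IHu _ IHv|c v Ic].
- by rewrite scaler0; apply: ideal_mul0.
- by rewrite scalerDr; apply: ideal_mulD.
- by rewrite scalerA; apply: ideal_mulZ.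
Qed.

Definition ideal_add1 I r : set R :=
  [set x | exists i s, I i /\ x = i + s * r]%classic.

Lemma ideal_add1_ideal I r : is_ideal I -> is_ideal (ideal_add1 I r).
Proof.
case=> I0 ID IM; split.
- by exists 0, 0; rewrite mul0r addr0.
- move=> x y [i [s [Ii ->]]] [j [t [Ij ->]]]; exists (i + j), (s + t).
  by split; [apply: ID | rewrite mulrDl addrACA].
- move=> t x [i [s [Ii ->]]]; exists (t * i), (t * s).
  by split; [apply: IM | rewrite mulrDr mulrA].
Qed.

Lemma sub_ideal_add1 I r : (I `<=` ideal_add1 I r)%classic.
Proof. by move=> x Ix; exists x, 0; rewrite mul0r addr0. Qed.

Lemma ideal_add1_mem I r : is_ideal I -> ideal_add1 I r r.
Proof. by case=> I0 _ _; exists 0, 1; rewrite mul1r add0r. Qed.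

Lemma ideal_add1_mul I r (z : Z) :
  ideal_mul (ideal_add1 I r) z -> exists y, ideal_mul I (z - r *: y).
Proof.
elim=> {z} [|u v _ [y1 h1] _ [y2 h2]|_ v [i [s [Ii ->]]]].
- by exists 0; rewrite scaler0 subr0; apply: ideal_mul0.
- exists (y1 + y2); rewrite scalerDr opprD addrACA; exact: ideal_mulD.
- exists (s *: v); rewrite scalerDl scalerA (mulrC r) addrK.
  exact: ideal_mulZ.
Qed.

(** Projectivity chooses the quotient b linearly. Both e and d a + a d commute with d modulo I, the
    latter because d^2 is the scalar w; hence so does r b, and flatness divides this by r. *)
Lemma bounds_mod_divide I r a e : is_ideal I -> commutes_mod I e ->
  bounds_mod (ideal_add1 I r) a e ->
  exists b, commutes_mod (colon I r) b /\
    forall z, ideal_mul I (e z - (d (a z) + a (d z)) - r *: b z).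
Proof.
move=> idI ce ha; have [projZ flatZ _] := tameZ.
have [|v|b hb] := projZ Z (fun z y =>
    ideal_mul I (e z - (d (a z) + a (d z)) - r *: y)).
- move=> s v y v' y' h h'.
  have := ideal_mulD (ideal_mul_scale s idI h) h'; congr ideal_mul.
  rewrite !linearP /=.
  by zmod.
- exact: ideal_add1_mul (ha v).
exists b; split=> // z; apply: flatZ => //.
have := ideal_mulD (ideal_mulB idI (ce z)
  (ideal_mul_linear d (hb z))) (hb (d z)).
congr ideal_mul; rewrite !(linearB, linearD, linearZ) /= !dd [a (w *: _)]linearZ /=.
by zmod.
Qed.

Lemma bounds_mod_combine I r a b c e : is_ideal I ->
  (forall z, ideal_mul I (e z - (d (a z) + a (d z)) - r *: b z)) ->
  bounds_mod (colon I r) c b ->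
  bounds_mod I (a \+ (r \*: c) : {linear Z -> Z}) e.
Proof.
move=> idI hb hc z.
have := ideal_mulD (hb z) (ideal_mul_colon (hc z)); congr ideal_mul.
by rewrite /= !(linearB, linearD, linearZ) /=; zmod.
Qed.

(** As (I : r) = I, the remainder b is again a cycle modulo I and can be divided again, up to e = d
    a + a d + r^N b. Then [lam \o b] bounds r^N b, since b commutes with d modulo I. *)
Lemma bounds_mod_nilpotent I r N lam : is_ideal I -> colon I r = I ->
  (forall z, r ^+ N *: z = d (lam z) + lam (d z)) ->
  (forall e, commutes_mod I e -> exists a, bounds_mod (ideal_add1 I r) a e) ->
  forall e, commutes_mod I e -> exists a, bounds_mod I a e.
Proof.
move=> idI colI hlam IH e ce.
suff [a [b [cb hb]]] : exists a b, commutes_mod I b /\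
    forall z, ideal_mul I (e z - (d (a z) + a (d z)) - r ^+ N *: b z).
  exists (a \+ (lam \o b) : {linear Z -> Z}) => z.
  have := ideal_mulD (hb z) (ideal_mul_linear lam (cb z)); congr ideal_mul.
  by rewrite /= !(linearB, linearD) /= hlam; zmod.
elim: N {hlam} => [|N [a [b [cb hb]]]].
  exists (\0 : {linear Z -> Z}), e; split=> // z.
  rewrite /= linear0 scale1r addr0 subr0 subrr; exact: ideal_mul0.
have [a' ha'] := IH b cb.
have [b' [cb' hb']] := bounds_mod_divide idI cb ha'.
exists (a \+ (r ^+ N \*: a') : {linear Z -> Z}), b'; split; first by rewrite colI in cb'.
move=> z; have := ideal_mulD (hb z) (ideal_mul_scale (r ^+ N) idI (hb' z)).
congr ideal_mul; rewrite exprSr /= !(linearB, linearD, linearZ) /=.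
by zmod.
Qed.

Hypothesis nullhomotopic : forall r, m r ->
  exists N lam, forall z, r ^+ N *: z = d (lam z) + lam (d z).
Variable h0 : {linear Z -> Z}.
Hypothesis contraction_mod_m : bounds_mod m h0 (idfun : {linear Z -> Z}).

Lemma commutes_bounds_mod I : is_ideal I ->
  forall e, commutes_mod I e -> exists a, bounds_mod I a e.
Proof.
move: I; apply: noetherian_ind => // I idI IH e ce.
have [I1|nI1] := pselect (I 1).
  exists (\0 : {linear Z -> Z}) => z.
  by rewrite -[X in ideal_mul _ X]scale1r; apply: ideal_mulZ.
have sIm := proper_ideal_sub noethR locR idI nI1.
have [[r [mr nIr]]|noR] := pselect (exists r, m r /\ ~ I r); last first.
  have eI : I = m.
    apply/seteqP; split=> // x mx.
    by apply: contrapT => nIx; apply: noR; exists x.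
  (* Since e commutes with d modulo m, composing 1 = d h0 + h0 d with e bounds e. *)
  exists (h0 \o e : {linear Z -> Z}) => z; rewrite eI in ce *.
  have := ideal_mulD (contraction_mod_m (e z)) (ideal_mul_linear h0 (ce z)).
  by congr ideal_mul; rewrite /= linearB; zmod.
have IHadd : forall e', commutes_mod I e' ->
    exists a, bounds_mod (ideal_add1 I r) a e'.
  move=> e' ce'; apply: IH.
  - exact: ideal_add1_ideal.
  - exact: sub_ideal_add1.
  - by move=> eI; apply: nIr; rewrite -eI; apply: ideal_add1_mem.
  - by move=> z; apply: ideal_mul_sub (ce' z); apply: sub_ideal_add1.
have [colI|ncolI] := pselect (colon I r = I).
  have [N [lam hlam]] := nullhomotopic mr.
  exact: bounds_mod_nilpotent hlam IHadd _ ce.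
have [a ha] := IHadd e ce.
have [b [cb hb]] := bounds_mod_divide idI ce ha.
have [c hc] := IH _ (colon_ideal _ idI) (sub_colon _ idI) ncolI b cb.
by exists (a \+ (r \*: c) : {linear Z -> Z}); apply: bounds_mod_combine hb hc.
Qed.

Lemma contractible : exists a, forall z, z = d (a z) + a (d z).
Proof.
pose I0 : set R := [set 0]%classic.
have idI0 : is_ideal I0.
  split=> //; first by move=> x y -> ->; rewrite /I0 /= addr0.
  by move=> a x ->; rewrite /I0 /= mulr0.
have I0Z z : ideal_mul I0 z -> z = 0 :> Z.
  elim=> {z} [|u v _ -> _ ->|a v ->] //; by rewrite ?addr0 ?scale0r.
have [|a ha] := commutes_bounds_mod idI0 (e := idfun : {linear Z -> Z}).
  by move=> z /=; rewrite subrr; apply: ideal_mul0.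
by exists a => z; apply/subr0_eq/I0Z/ha.
Qed.

End Contraction.

(** * Reduction to the residue field *)

Section VectorSpaceContraction.
Variables (k : fieldType) (T : lmodType k) (d : {linear T -> T}).
Hypothesis dd : forall t, d (d t) = 0.
Hypothesis acyclic : forall t, d t = 0 -> exists s, t = d s.

(** Zorn's lemma gives a subspace U maximal among those meeting ker d trivially. If t were outside U
    + ker d, then U + k t would still meet ker d trivially. *)
Lemma kernel_complement : exists U : set T,
  [/\ forall c u v, U u -> U v -> U (c *: u + v),
      forall u, U u -> d u = 0 -> u = 0
    & forall t, exists u, U u /\ d (t - u) = 0].
Proof.
pose P (U : set T) := [/\ U 0, forall c u v, U u -> U v -> U (c *: u + v)
  & forall u, U u -> d u = 0 -> u = 0].
have [|F [A FA] FP Ftot|U [[U0 UP Uker] Umax]] := @Zorn_above T P [set 0]%classic.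
- by split=> //= c u v -> ->; rewrite scaler0 addr0.
- split.
  + by exists A => //; case: (FP _ FA).
  + move=> c u v [B FB Bu] [B' FB' B'v].
    have [sB|sB] := Ftot _ _ FB FB'; [exists B'|exists B] => //.
      by case: (FP _ FB') => _ BP _; apply: BP => //; apply: sB.
    by case: (FP _ FB) => _ BP _; apply: BP => //; apply: sB.
  + by move=> u [B FB Bu]; case: (FP _ FB) => _ _; apply.
exists U; split=> // t; apply: contrapT => not.
pose U' : set T := [set x | exists u c, U u /\ x = u + c *: t]%classic.
have UU' : (U `<=` U')%classic.
  by move=> u Uu; exists u, 0; rewrite scale0r addr0.
have U't : U' t by exists 0, 1; rewrite scale1r add0r.
have PU' : P U'.
  split; first exact: UU'.
    move=> c x y [u [a [Uu ->]]] [v [b [Uv ->]]].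
    exists (c *: u + v), (c * a + b); split; first exact: UP.
    by rewrite scalerDr scalerA scalerDl addrACA.
  move=> x [u [c [Uu ->]]] dx.
  have [c0|c0] := eqVneq c 0.
    by move: dx; rewrite c0 scale0r addr0; apply: Uker.
  (* With c invertible, u + c t in ker d puts t + c^-1 u there too, against the choice of t. *)
  case: not; exists (- c^-1 *: u); split.
    by rewrite -[_ *: u]addr0; apply: UP.
  rewrite scaleNr opprK.
  have -> : t + c^-1 *: u = c^-1 *: (u + c *: t).
    by rewrite scalerDr scalerA mulVf // scale1r addrC.
  by rewrite linearZ /= dx scaler0.
apply: not; exists t; rewrite -(Umax _ PU' UU') subrr linear0; by split.
Qed.

(* T = U + d U is a direct sum for a complement U of the kernel; the
   contraction sends u + d u' to u'. *)
Lemma vector_space_contraction :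
  exists h : {linear T -> T}, forall t, t = d (h t) + h (d t).
Proof.
have [U [UP Uker Utot]] := kernel_complement.
have [h0 h0P] : {h : T -> T & forall t, U (h t) /\
    exists2 u, U u & t = u + d (h t)}.
  apply: (@choice _ _ (fun t y => U y /\ exists2 u, U u & t = u + d y)) => t.
  (* The cycle t - u is a boundary d s, and s may be replaced by its component u' in U, as d kills
     the difference. *)
  have [u [Uu /acyclic [s ts]]] := Utot t.
  have [u' [Uu' du']] := Utot s.
  exists u'; split=> //; exists u => //.
  apply: subr0_eq; rewrite opprD addrA ts -linearB; exact: du'.
have U0 : U 0.
  have [u [Uu _]] := Utot 0.
  by have := UP (-1) _ _ Uu Uu; rewrite scaleN1r addNr.
(* Since d is injective on U, d t = d u determines u, and then d u' determines u'. Linearity of [h0]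
   follows from this uniqueness. *)
have h_uniq t u u' : U u -> U u' -> t = u + d u' -> h0 t = u'.
  move=> Uu Uu' tE; have [Uh [v Uv tE']] := h0P t.
  have UB x y : U x -> U y -> U (x - y).
    by move=> Ux Uy; rewrite addrC -scaleN1r; apply: UP.
  have duv : d (u - v) = 0.
    have := congr1 d tE; rewrite {1}tE' !(linearD d) !dd !addr0 => dvu.
    by rewrite linearN dvu subrr.
  have uv : u = v by apply/subr0_eq/Uker => //; apply: UB.
  apply/subr0_eq/Uker; first exact: UB.
  rewrite linearB; apply/eqP; rewrite subr_eq0; apply/eqP.
  by apply: (addrI v); rewrite -tE' -{1}uv.
have lh : linear h0.
  move=> c x y; have [Ux [u Uu xE]] := h0P x; have [Uy [v Uv yE]] := h0P y.
  apply: (h_uniq _ (c *: u + v)); [exact: UP|exact: UP|].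
  by rewrite {1}xE {1}yE linearP scalerDr addrACA.
exists (linear_of lh) => t /=; have [Uh [u Uu tE]] := h0P t.
rewrite [h0 (d t)](h_uniq _ 0 u) //; first by rewrite addrC.
by rewrite {1}tE linearD dd addr0 add0r.
Qed.

End VectorSpaceContraction.

Section ResidueField.
Variables (k : fieldType) (R : comAlgType k) (m : set R).
Variable res : {lrmorphism R -> k | *%R}.
Hypotheses (idm : is_ideal m) (res_m : is_residue_map m res).

Let resA (c : k) : res c%:A = c.
Proof. by rewrite linearZ /= rmorph1 mulr1. Qed.

Section Tensor1.
Variable V : lmodType R.

Lemma tens1D (x y : V) : tens res 1 (x + y) = tens res 1 x + tens res 1 y.
Proof. rewrite -tensor_piD; apply/tens_piE; exact: tens_Dr. Qed.

Lemma tens1Z r (x : V) : tens res 1 (r *: x) = res r *: tens res 1 x.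
Proof.
rewrite -tensor_piZ; apply/tens_piE => /=; rewrite mulrC.
exact/tens_sym/tens_Z.
Qed.

Lemma tens10 : tens res 1 (0 : V) = 0.
Proof. by rewrite -[X in tens _ _ X](scale0r 0) tens1Z rmorph0 scale0r. Qed.

Lemma tens1N (x : V) : tens res 1 (- x) = - tens res 1 x.
Proof. by rewrite -scaleN1r tens1Z rmorphN1 scaleN1r. Qed.

(** An inverse of [tens res 1] on representatives, through the embedding of k in R; it is well
    defined only modulo m V. *)
Let collapse (s : seq (k * V)) : V := \sum_(z <- s) z.1%:A *: z.2.

Lemma tens1_surj (t : tensor res V) : exists x, t = tens res 1 x.
Proof.
elim/tens_ind: t => s; exists (collapse s); rewrite /collapse.
elim: s => [|[a x] s IH]; first by rewrite big_nil tens10.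
rewrite big_cons tens1D -IH tens1Z resA -cat1s tensor_piD; congr (_ + _).
by rewrite -tensor_piZ /= mulr1.
Qed.

Lemma tens1_ker (x : V) : tens res 1 x = 0 -> ideal_mul m x.
Proof.
have rel s t : tens_rel res s t -> ideal_mul m (collapse s - collapse t).
  rewrite /collapse; elim=> {s t}.
  - by move=> s; rewrite subrr; apply: ideal_mul0.
  - by move=> s t _ /(ideal_mulN idm); rewrite opprB.
  - move=> s t u _ h1 _ h2; have := ideal_mulD h1 h2.
    by rewrite addrA subrK.
  - move=> s s' t t' _ h1 _ h2; have := ideal_mulD h1 h2.
    by rewrite !big_cat opprD addrACA.
  - by move=> s t; rewrite !big_cat /= addrC subrr; apply: ideal_mul0.
  - move=> y; rewrite big_nil big_seq1 /= !scale0r subr0; exact: ideal_mul0.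
  - move=> a b y; rewrite !big_cons !big_nil /= !addr0 !scalerDl subrr.
    exact: ideal_mul0.
  - move=> a y z; rewrite !big_cons !big_nil /= !addr0 scalerDr subrr.
    exact: ideal_mul0.
  (* This is the generating relation that holds only modulo m V: [res] takes the same value on both
     scalars. *)
  - move=> a r y; rewrite !big_seq1 /= scalerA -scalerBl; apply: ideal_mulZ.
    apply/res_m; rewrite rmorphB rmorphM.
    apply/eqP; rewrite subr_eq0; apply/eqP.
    by transitivity (a * res r); [apply: resA|rewrite -[a in LHS]resA].
move=> x0; have /rel : tens_rel res [:: (1, x)] [::].
  exact/tens_piE.
by rewrite /collapse big_nil big_seq1 /= !scale1r subr0.
Qed.

End Tensor1.

(** The map [p] stands for the reduction of Z to k (x) Z, kept abstract because that of a cone is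
    assembled from four tensor products. Projectivity lifts the contraction of T to Z. *)
Lemma contraction_mod_maximal (Z : lmodType R) (d : {linear Z -> Z})
    (T : lmodType k) (p : Z -> T) (dT : {linear T -> T}) :
  projective Z ->
  (forall x y, p (x + y) = p x + p y) ->
  (forall r x, p (r *: x) = res r *: p x) ->
  (forall t, exists x, t = p x) ->
  (forall x, p x = 0 -> ideal_mul m x) ->
  (forall x, p (d x) = dT (p x)) ->
  (forall t, dT (dT t) = 0) -> (forall t, dT t = 0 -> exists s, t = dT s) ->
  exists h : {linear Z -> Z}, bounds_mod d m h (idfun : {linear Z -> Z}).
Proof.
move=> projZ pD pZ psurj pker pd ddT acT.
have [hT hTE] := vector_space_contraction ddT acT.
have [r v u v' u' e e'|v|h hE] := projZ Z (fun v u => p u = hT (p v)).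
- by rewrite !pD !pZ e e' linearP.
- by have [u ->] := psurj (hT (p v)); exists u.
exists h => z /=; apply: pker.
have pN x : p (- x) = - p x by rewrite -scaleN1r pZ rmorphN1 scaleN1r.
by rewrite pD pN pD pd !hE pd {1}(hTE (p z)) subrr.
Qed.

(* The powers of r are linearly dependent modulo J, and the coefficient of the
   lowest power occurring in a dependency is a unit. *)
Lemma finite_codim_power (J : set R) r :
  noetherian R -> is_local m -> is_ideal J -> finite_codim J -> m r ->
  exists N, J (r ^+ N).
Proof.
move=> noethR locR [J0 JD JM] [N [e he]] mr.
have JZ c x : J x -> J (c *: x) by rewrite -mulr_algl; apply: JM.
have Jsum (I : finType) (F : I -> R) : (forall i, J (F i)) -> J (\sum_i F i).
  by move=> h; apply: (big_ind J) => // i _; apply: h.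
have [c hc] := choice (fun j : 'I_N.+1 => he (r ^+ j)).
(* With N + 1 rows and N columns, [A] has dependent rows. *)
pose A := \matrix_(j < N.+1, i < N) c j i.
have kerA : kermx A != 0.
  rewrite -mxrank_eq0 mxrank_ker subn_eq0 -ltnNge ltnS.
  exact: rank_leq_col.
have [v /sub_kermxP vA v0] := rowV0Pn kerA.
have {}vA i : \sum_j v 0 j * c j i = 0.
  have := congr1 (fun M : 'rV_N => M 0 i) vA; rewrite !mxE => vAi.
  by rewrite -[RHS]vAi; apply: eq_bigr => j _; rewrite !mxE.
have Jv : J (\sum_j v 0 j *: r ^+ j).
  have -> : \sum_j v 0 j *: r ^+ j =
      \sum_j v 0 j *: (r ^+ j - \sum_i c j i *: e i).
    under [RHS]eq_bigr => j _ do rewrite scalerBr.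
    rewrite sumrB -[LHS]subr0; congr (_ - _).
    under eq_bigr => j _ do rewrite scaler_sumr.
    rewrite exchange_big big1 // => i _.
    under eq_bigr => j _ do rewrite scalerA.
    by rewrite -scaler_suml vA scale0r.
  by apply: Jsum => j; apply: JZ.
have [j0 vj0] : exists j, v 0 j != 0.
  apply/existsP; apply: contraR v0; rewrite negb_exists => /forallP h.
  by apply/eqP/rowP => j; rewrite mxE; apply/eqP; rewrite -[_ == _]negbK.
have [j vj jmin] := arg_minnP (P := fun j => v 0 j != 0) (fun j => j : nat) vj0.
(* Where i < j the subtraction truncates, but there [v 0 i] is 0. *)
pose u := \sum_i v 0 i *: r ^+ (i - j).
have [_ mD mM] := idm.
(* The term i = j of u is a nonzero scalar; the others are 0 or multiples of r, which lies in m. *)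
have nmu : ~ m u.
  rewrite /u (bigD1 j) //= subnn expr0 => mu.
  set s := \sum_(i < _ | _) _ in mu.
  have ms : m s.
    apply: (big_ind m) => [||i ij]; [by case: idm | exact: mD |].
    have [->|vi] := eqVneq (v 0 i) 0; first by rewrite scale0r; case: idm.
    have ltji : (j < i)%N by rewrite ltn_neqAle eq_sym ij jmin.
    by rewrite -mulr_algl -(subnSK ltji) exprSr mulrA; apply: mM.
  have : res (v 0 j)%:A = 0.
    apply/res_m; rewrite -[_%:A](addrK s); apply: mD => //.
    by rewrite -mulN1r; apply: mM.
  by rewrite resA => /eqP; rewrite (negPf vj).
have [a au] := local_unit noethR locR nmu.
exists j; suff Ju : J (r ^+ j * u).
  by rewrite -[r ^+ j]mulr1 -au mulrCA; apply: JM.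
rewrite /u mulr_sumr; move: Jv; congr J; apply: eq_bigr => i _.
have [->|vi] := eqVneq (v 0 i) 0; first by rewrite !scale0r mulr0.
by rewrite -scalerAr -exprD subnKC // jmin.
Qed.

End ResidueField.

(** * Null-homotopic scalars *)

Section NullHomotopy.
Variables (R : comNzRingType) (Z : lmodType R) (w : R) (d : {linear Z -> Z}).
Hypothesis dd : forall z, d (d z) = w *: z.

Definition nullhomotopic r :=
  exists lam : {linear Z -> Z}, forall z, r *: z = d (lam z) + lam (d z).

Lemma nullhomotopic_ideal : is_ideal [set r | nullhomotopic r]%classic.
Proof.
split.
- by exists (\0 : {linear Z -> Z}) => z; rewrite /= scale0r linear0 addr0.
- move=> r s [a ha] [b hb]; exists (a \+ b : {linear Z -> Z}) => z.
  by rewrite scalerDl ha hb /= linearD addrACA.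
- move=> s r [a ha]; exists (s \*: a : {linear Z -> Z}) => z.
  by rewrite -scalerA ha /= linearZ scalerDr.
Qed.

(* Commuting d with a connection along D is R-linear, and D(d^2) = D w. *)
Lemma nullhomotopic_derivation (D : R -> R) :
  has_connections Z ->
  (forall a b, D (a + b) = D a + D b) ->
  (forall a b, D (a * b) = a * D b + D a * b) ->
  nullhomotopic (D w).
Proof.
move=> conn DD DM; have [N [ND NZ]] := conn D DD DM.
have N0 : N 0 = 0 by apply: (addrI (N 0)); rewrite -ND !addr0.
have NN x : N (- x) = - N x.
  by apply: (addrI (N x)); rewrite -ND !subrr N0.
have lf : linear (fun z => N (d z) - d (N z)).
  by move=> r x y; rewrite linearP ND NZ ND NZ !(linearD, linearZ) /=; zmod.
exists (linear_of lf) => z /=.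
by rewrite !dd NZ linearB !dd; zmod.
Qed.

(** For [eps] the projection onto the even part, the hypothesis says that d is odd. Applying d to it
    gives w = d (d eps) + (d eps) d. *)
Lemma nullhomotopic_graded (eps : {linear Z -> Z}) :
  (forall z, d z = eps (d z) + d (eps z)) -> nullhomotopic w.
Proof.
move=> epsd; exists (d \o eps : {linear Z -> Z}) => z /=.
by rewrite -linearD addrC -epsd dd.
Qed.

End NullHomotopy.

(** * Cones *)

Section Cone.
Variables (K : comNzRingType) (X0 X1 Y0 Y1 : lmodType K).
Variables (dX0 : {linear X0 -> X1}) (dX1 : {linear X1 -> X0}).
Variables (dY0 : {linear Y0 -> Y1}) (dY1 : {linear Y1 -> Y0}).
Variables (f0 : {linear X0 -> Y0}) (f1 : {linear X1 -> Y1}).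

(** Summands are grouped by object, not by parity. The signs on the shifted copy of X make the mixed
    terms of the square cancel. *)
Definition cone_fun (z : (Y0 * Y1) * (X0 * X1)) : (Y0 * Y1) * (X0 * X1) :=
  ((dY1 z.1.2 + f0 z.2.1, dY0 z.1.1 + f1 z.2.2), (- dX1 z.2.2, - dX0 z.2.1)).

Lemma cone_fun_linear : linear cone_fun.
Proof.
move=> r x y; congr ((_, _), (_, _)) => /=; rewrite !linearP /=;
  by rewrite ?scalerDr ?scalerN ?opprD // addrACA.
Qed.

Definition cone := linear_of cone_fun_linear.

Lemma cone_sq (w : K) :
  (forall x, dX1 (dX0 x) = w *: x) -> (forall x, dX0 (dX1 x) = w *: x) ->
  (forall y, dY1 (dY0 y) = w *: y) -> (forall y, dY0 (dY1 y) = w *: y) ->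
  (forall x, dY0 (f0 x) = f1 (dX0 x)) -> (forall x, dY1 (f1 x) = f0 (dX1 x)) ->
  forall z, cone (cone z) = w *: z.
Proof.
move=> X10 X01 Y10 Y01 fd0 fd1 [[y0 y1] [x0 x1]].
congr ((_, _), (_, _)) => /=; rewrite /= ?linearD ?linearN /=.
- by rewrite Y10 fd1; zmod.
- by rewrite Y01 fd0; zmod.
- by rewrite X10 opprK.
- by rewrite X01 opprK.
Qed.

(** X is shifted in the cone, so the even part is Y0 + X1. *)
Definition even_fun (z : (Y0 * Y1) * (X0 * X1)) : (Y0 * Y1) * (X0 * X1) :=
  ((z.1.1, 0), (0, z.2.2)).

Lemma even_fun_linear : linear even_fun.
Proof. by move=> r x y; congr ((_, _), (_, _)); rewrite /= scaler0 addr0. Qed.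

Lemma cone_even z :
  cone z = linear_of even_fun_linear (cone z) + cone (linear_of even_fun_linear z).
Proof.
case: z => [[y0 y1] [x0 x1]]; congr ((_, _), (_, _)) => /=;
  by rewrite ?linear0 ?oppr0 ?addr0 ?add0r.
Qed.

End Cone.

(** Injectivity in cohomology makes the X components of a cycle boundaries; surjectivity then treats
    the Y components. *)
Lemma cone_acyclic (K : comNzRingType) (C D : complex2 K)
    (phi : chain_map2 C D) : quasi_iso phi ->
  forall z, cone (cpx_d0 C) (cpx_d1 C) (cpx_d0 D) (cpx_d1 D)
                 (chm0 phi) (chm1 phi) z = 0 ->
  exists s, z = cone (cpx_d0 C) (cpx_d1 C) (cpx_d0 D) (cpx_d1 D)
                     (chm0 phi) (chm1 phi) s.
Proof.
move=> [[i0 s0] [i1 s1]] [[y0 y1] [x0 x1]] [e0 e1 /eqP e2 /eqP e3].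
rewrite oppr_eq0 /= in e2; rewrite oppr_eq0 /= in e3.
move/eqP: e2 => e2; move/eqP: e3 => e3; rewrite /= in e0 e1.
have [|z1 x0E] := i0 x0 e3.
  exists (- y1); rewrite linearN; apply: (addrI (cpx_d1 D y1)).
  by rewrite e0 subrr.
have [|z0 x1E] := i1 x1 e2.
  exists (- y0); rewrite linearN; apply: (addrI (cpx_d0 D y0)).
  by rewrite e1 subrr.
(* The correction by z0 turns y0 into a cycle of Y, to which surjectivity applies. *)
have [|u0 [du0 [v1 v1E]]] := s0 (y0 + chm0 phi z0).
  by rewrite linearD chm_d0 -x1E.
have [|u1 [du1 [v0 v0E]]] := s1 (y1 + chm1 phi z1).
  by rewrite linearD chm_d1 -x0E.
exists ((v0, v1), (u0 - z0, u1 - z1)).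
congr ((_, _), (_, _)) => /=.
- by rewrite -v1E linearB; zmod.
- by rewrite -v0E linearB; zmod.
- by rewrite linearB du1 -x0E; zmod.
- by rewrite linearB du0 -x1E; zmod.
Qed.

(** Read [a] as a block matrix: its Y to X block is the homotopy inverse, its diagonal blocks are
    the two homotopies. Only entries that are odd for the parity of the cone are read off. *)
Lemma cone_contraction_homotopy_iso (R : comNzRingType) (w : R)
    (X Y : MFinf w) (f : hom0 X Y)
    (d := cone (mf_d0 X) (mf_d1 X) (mf_d0 Y) (mf_d1 Y) f.1 f.2)
    (a : {linear ((mf0 Y * mf1 Y) * (mf0 X * mf1 X))%type ->
                 ((mf0 Y * mf1 Y) * (mf0 X * mf1 X))%type}) :
  (forall z, z = d (a z) + a (d z)) -> homotopy_iso f.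
Proof.
move=> ha.
pose Z : lmodType R := ((mf0 Y * mf1 Y) * (mf0 X * mf1 X))%type.
pose jY0 : {linear mf0 Y -> Z} := pair_inl (mf0 X * mf1 X)%type \o pair_inl (mf1 Y).
pose jY1 : {linear mf1 Y -> Z} := pair_inl (mf0 X * mf1 X)%type \o pair_inr (mf0 Y).
pose jX0 : {linear mf0 X -> Z} := pair_inr (mf0 Y * mf1 Y)%type \o pair_inl (mf1 X).
pose jX1 : {linear mf1 X -> Z} := pair_inr (mf0 Y * mf1 Y)%type \o pair_inr (mf0 X).
pose qY0 : {linear Z -> _} := fst \o fst.
pose qY1 : {linear Z -> _} := snd \o fst.
pose qX0 : {linear Z -> _} := fst \o snd.
pose qX1 : {linear Z -> _} := snd \o snd.
have dY0 y : d (jY0 y) = jY1 (mf_d0 Y y).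
  by congr ((_, _), (_, _)); rewrite /= ?linear0 ?oppr0 ?addr0.
have dY1 y : d (jY1 y) = jY0 (mf_d1 Y y).
  by congr ((_, _), (_, _)); rewrite /= ?linear0 ?oppr0 ?addr0.
have dX0 x : d (jX0 x) = jY0 (f.1 x) - jX1 (mf_d0 X x).
  by congr ((_, _), (_, _)); rewrite /= ?linear0 ?oppr0 ?addr0 ?add0r.
have dX1 x : d (jX1 x) = jY1 (f.2 x) - jX0 (mf_d1 X x).
  by congr ((_, _), (_, _)); rewrite /= ?linear0 ?oppr0 ?addr0 ?add0r.
pose g : hom0 Y X := (qX0 \o a \o jY0 : {linear _ -> _},
                      qX1 \o a \o jY1 : {linear _ -> _}).
(* On the Y block the contraction reads 1 = f g + d b + b d, whence the sign; on the X block the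
   cone carries - d and the sign disappears. *)
pose hY : hom1 Y Y := (\- (qY1 \o a \o jY0) : {linear _ -> _},
                       \- (qY0 \o a \o jY1) : {linear _ -> _}).
pose hX : hom1 X X := (qX1 \o a \o jX0 : {linear _ -> _},
                       qX0 \o a \o jX1 : {linear _ -> _}).
exists g; split.
- split=> y /=; apply/eqP; rewrite subr_eq0; apply/eqP.
  + have := congr1 qX1 (ha (jY0 y)); rewrite linearD dY0 /= => e.
    by apply: (addrI (- mf_d0 X (a (jY0 y)).2.1)); rewrite addNr.
  + have := congr1 qX0 (ha (jY1 y)); rewrite linearD dY1 /= => e.
    by apply: (addrI (- mf_d1 X (a (jY1 y)).2.2)); rewrite addNr.
- exists hX; split=> x /=.
  + have := congr1 qX0 (ha (jX0 x)); rewrite linearD dX0 linearB /= => e.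
    by rewrite {2}e; zmod.
  + have := congr1 qX1 (ha (jX1 x)); rewrite linearD dX1 linearB /= => e.
    by rewrite {2}e; zmod.
- exists hY; split=> y /=.
  + have := congr1 qY0 (ha (jY0 y)); rewrite linearD dY0 /= => e.
    by rewrite {2}e linearN; zmod.
  + have := congr1 qY1 (ha (jY1 y)); rewrite linearD dY1 /= => e.
    by rewrite {2}e linearN; zmod.
Qed.

(** The cone of k (x) f is acyclic, and [p], which reduces the four summands separately, intertwines
    the two cone differentials. *)
Lemma cone_contractible_mod (k : fieldType) (R : comAlgType k) (m : set R)
    (idm : is_ideal m) (res : {lrmorphism R -> k | *%R})
    (res_m : is_residue_map m res) (w : R) (pw : res w = 0)
    (X Y : MFinf w) (f : hom0 X Y) (cycf : is_cycle0 f)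
    (d := cone (mf_d0 X) (mf_d1 X) (mf_d0 Y) (mf_d1 Y) f.1 f.2) :
  tame ((mf0 Y * mf1 Y) * (mf0 X * mf1 X))%type ->
  quasi_iso (tensor_mf_map res pw cycf) ->
  exists h : {linear _ -> _}, bounds_mod d m h (idfun : {linear _ -> _}).
Proof.
move=> [projZ _ _] /cone_acyclic; set phi := tensor_mf_map _ _ _ => acT.
pose C := tensor_mf res pw X; pose D := tensor_mf res pw Y.
pose dT := cone (cpx_d0 C) (cpx_d1 C) (cpx_d0 D) (cpx_d1 D)
                (chm0 phi) (chm1 phi).
pose p (z : (mf0 Y * mf1 Y) * (mf0 X * mf1 X)) :
    (cpx0 D * cpx1 D) * (cpx0 C * cpx1 C) :=
  ((tens res 1 z.1.1, tens res 1 z.1.2), (tens res 1 z.2.1, tens res 1 z.2.2)).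
have ddT t : dT (dT t) = 0.
  (* Complexes are the case w = 0 of [cone_sq]. *)
  rewrite -[RHS](scale0r t); apply: cone_sq => x; rewrite ?scale0r.
  - exact: cpx_d1d0.
  - exact: cpx_d0d1.
  - exact: cpx_d1d0.
  - exact: cpx_d0d1.
  - exact: chm_d0.
  - exact: chm_d1.
apply: (contraction_mod_maximal (res := res) (p := p) (dT := dT)) => //.
- by move=> x y; congr ((_, _), (_, _)); apply: tens1D.
- by move=> r x; congr ((_, _), (_, _)); apply: tens1Z.
- move=> [[t1 t2] [t3 t4]]; have [y0 ->] := tens1_surj t1.
  have [y1 ->] := tens1_surj t2; have [x0 ->] := tens1_surj t3.
  by have [x1 ->] := tens1_surj t4; exists ((y0, y1), (x0, x1)).
- move=> [[y0 y1] [x0 x1]] [] /(tens1_ker idm res_m) h0.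
  move=> /(tens1_ker idm res_m) h1 /(tens1_ker idm res_m) h2.
  move=> /(tens1_ker idm res_m) h3.
  by do 2![apply: ideal_mul_pair].
- move=> [[y0 y1] [x0 x1]]; congr ((_, _), (_, _)).
  + rewrite tens1D; congr (_ + _); exact/esym/tens_map_tens.
  + rewrite tens1D; congr (_ + _); exact/esym/tens_map_tens.
  + rewrite tens1N; congr (- _); exact/esym/tens_map_tens.
  + rewrite tens1N; congr (- _); exact/esym/tens_map_tens.
Qed.

(** * The two implications *)

Lemma homotopy_iso_quasi_iso (k : fieldType) (R : comAlgType k)
    (res : {lrmorphism R -> k | *%R}) (w : R) (pw : res w = 0)
    (X Y : MFinf w) (f : hom0 X Y) (cycf : is_cycle0 f) :
  homotopy_iso f -> quasi_iso (tensor_mf_map res pw cycf).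
Proof.
(* Homotopy identities survive the base change; every tensor being of the form 1 (x) y, they are
   checked on those. *)
have tensH (V W V1 : lmodType R) (u : {linear V -> W}) (v : {linear W -> V})
    (s : {linear V -> V1}) (s' : {linear V1 -> V}) (t : {linear V -> V1})
    (t' : {linear V1 -> V}) :
    (forall x, v (u x) - x = s' (s x) + t' (t x)) ->
    forall x : tensor res V, tens_map v (tens_map u x) - x =
      tens_map s' (tens_map s x) + tens_map t' (tens_map t x).
  move=> e x; have [y ->] := tens1_surj x.
  by rewrite !tens_map_tens -tens1N -!tens1D e.
move=> [g [cycg [hX [gf0 gf1]] [hY [fg0 fg1]]]].
have gf0T := tensH _ _ _ _ _ _ _ _ _ gf0.
have gf1T := tensH _ _ _ _ _ _ _ _ _ gf1.
have fg0T := tensH _ _ _ _ _ _ _ _ _ fg0.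
have fg1T := tensH _ _ _ _ _ _ _ _ _ fg1.
pose gT := tensor_mf_map res pw cycg.
split; split.
- move=> x /= dx [y fx].
  (* From d x = 0 and f x = d y: x = g f x - d (hX x) = d (g y - hX x). *)
  exists (tens_map g.2 y - tens_map hX.1 x).
  have := gf0T x; rewrite dx linear0 addr0 fx => e.
  by rewrite linearB (chm_d1 gT) /= -e; zmod.
- move=> y /= dy; exists (tens_map g.1 y); split.
    by rewrite (chm_d0 gT) /= dy linear0.
  exists (- tens_map hY.1 y); have := fg0T y; rewrite dy linear0 addr0 => e.
  by rewrite /= linearN /= -e opprB.
- move=> x /= dx [y fx].
  exists (tens_map g.1 y - tens_map hX.2 x).
  have := gf1T x; rewrite dx linear0 addr0 fx => e.
  by rewrite linearB (chm_d0 gT) /= -e; zmod.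
- move=> y /= dy; exists (tens_map g.2 y); split.
    by rewrite (chm_d1 gT) /= dy linear0.
  exists (- tens_map hY.2 y); have := fg1T y; rewrite dy linear0 addr0 => e.
  by rewrite /= linearN /= -e opprB.
Qed.

Theorem corollary5p4 (k : fieldType) (R : comAlgType k) (m : set R) (n : nat)
    (regR : regular_local m n)
    (res : {lrmorphism R -> k | *%R})
    (res_m : is_residue_map m res)
    (w : R) (w_in_m : m w) (w_neq0 : w != 0)
    (D : 'I_n -> {linear R -> R})
    (derD : forall i, derivation (D i))
    (finD : finite_codim (ideal_mod_gen w (fun i => D i w)))
    (X Y : MFinf w) (f : hom0 X Y) (cycf : is_cycle0 f) :
  homotopy_iso f <->
  quasi_iso (tensor_mf_map res (proj1 (res_m w) w_in_m) cycf).
Proof.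
split=> [|quasi]; first exact: homotopy_iso_quasi_iso.
have [noethR locR _ _] := regR.
have idm : is_ideal m by case: locR.1.
pose Z : lmodType R := ((mf0 Y * mf1 Y) * (mf0 X * mf1 X))%type.
have tameZ : tame Z.
  by do 2![apply: tame_prod]; apply: free_tame;
     [apply: mf0_free|apply: mf1_free|apply: mf0_free|apply: mf1_free].
have [h0 h0P] := cone_contractible_mod idm res_m tameZ quasi.
set d := cone _ _ _ _ _ _ in h0P.
have dd z : d (d z) = w *: z.
  apply: cone_sq.
  - exact: mf_d1d0.
  - exact: mf_d0d1.
  - exact: mf_d1d0.
  - exact: mf_d0d1.
  - exact: is_cycle0_comm0.
  - exact: is_cycle0_comm1.
have idN := nullhomotopic_ideal d.
have [N0 ND NM] := idN.
(* The generator w is null-homotopic by parity, each [D i w] by a connection along [D i]. *)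
have sJN : (ideal_mod_gen w (fun i => D i w) `<=` nullhomotopic d)%classic.
  move=> x [a [c ->]]; apply: ND.
    by apply: NM; apply: nullhomotopic_graded dd _ (cone_even _ _ _ _ _ _).
  apply: ideal_sum idN _ => i; apply: NM; apply: nullhomotopic_derivation dd _ _ _ _.
  - by case: tameZ.
  - exact: linearD.
  - exact: derD.
have finN : finite_codim [set r | nullhomotopic d r]%classic.
  have [N [e he]] := finD; exists N, e => v; have [c hc] := he v.
  by exists c; apply: sJN.
have nullpow r : m r -> exists N (lam : {linear Z -> Z}),
    forall z, r ^+ N *: z = d (lam z) + lam (d z).
  exact: (finite_codim_power idm res_m noethR locR idN finN).
have [a ha] := contractible noethR locR tameZ dd nullpow h0P.
exact: cone_contraction_homotopy_iso ha.
Qed.
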